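(* For any $\varepsilon\in(0,1)$, there exists a randomized polynomial-time algorithm for consistent online monotone submodular maximization under a cardinality constraint $k$ that is $O(1/\varepsilon^2)$-consistent and provides a $(0.51-O(\varepsilon))$-approximation of the dynamic optimum.
   Context: Consistent online submodular maximization: a ground set $X$ of $n$ elements and a non-negative monotone submodular function $f:2^X\to\mathbb{R}_{\ge0}$. Elements $x_1,\dots,x_n$ arrive one by one; $X_t=\{x_1,\dots,x_t\}$. The algorithm does not know $n$ in advance and at time $t$ can query $f(S)$ for any $S\subseteq X_t$ via a value oracle; each query takes constant time when measuring running time. The input is fixed in advance by an oblivious adversary who knows the algorithm but not its random bits. After the arrival of $x_t$ the algorithm maintains a (possibly random) set $\mathrm{ALG}_t\subseteq X_t$ with $|\mathrm{ALG}_t|\le k$; $\mathrm{OPT}_t$ is a maximum-value subset of $X_t$ of size at most $k$. $\alpha$-approximation: $\mathbb{E}[f(\mathrm{ALG}_t)]\ge\alpha f(\mathrm{OPT}_t)$ for all $t$. $C$-consistent: $|\mathrm{ALG}_t\setminus\mathrm{ALG}_{t-1}|\le C$ for all $t$ and every realization of the random bits. *)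

(* Defs.v *)
From HB Require Import structures.
From mathcomp Require Import all_boot all_order all_algebra.
From mathcomp Require Import reals.

Set Implicit Arguments.
Unset Strict Implicit.
Unset Printing Implicit Defensive.

Import Order.TTheory GRing.Theory Num.Theory.
Local Open Scope ring_scope.

(* Computation model: a unit-cost machine with a value oracle and random bits,
   programmed in a while language.  A program names finitely many arrays of
   naturals and of reals; a scalar is a cell of an array.  Arithmetic on
   naturals is limited to + and truncated -, and arithmetic on reals to
   rational linear operations and comparison, so that a number computed in T
   steps is an affine form in the oracle answers (for reals) or in the inputs
   (for naturals) with coefficients of O(T) bits: unit cost hides no
   superpolynomial work, as it would with unit-cost products. *)

Inductive nexp : Type :=
| NConst of nat
| NCell of nat & nexp
| NAdd of nexp & nexp
| NSub of nexp & nexp.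

Inductive rexp : Type :=
| RConst of rat
| RCell of nat & nexp
| RAdd of rexp & rexp
| RScale of rat & rexp.

Inductive bexp : Type :=
| NLe of nexp & nexp
| RLe of rexp & rexp
| BNot of bexp
| BAnd of bexp & bexp.

(* [Query a e s] writes into cell e of real array a the value of the set whose
   characteristic vector is stored in natural array s; [Flip a e] writes a fresh
   random bit into cell e of natural array a. *)
Inductive cmd : Type :=
| Skip
| NSet of nat & nexp & nexp
| RSet of nat & nexp & rexp
| Query of nat & nexp & nat
| Flip of nat & nexp
| Seq of cmd & cmd
| If of bexp & cmd & cmd
| While of bexp & cmd.

(* [tape] is the stream of random bits that have not been read yet. *)
Record state (R : Type) : Type := State {
  nmem : nat -> nat -> nat;
  rmem : nat -> nat -> R;
  tape : nat -> bool
}.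

Definition upd (V : Type) (m : nat -> nat -> V) (a i : nat) (v : V) :
    nat -> nat -> V :=
  fun b j => if (b == a) && (j == i) then v else m b j.

Section Machine.
Variable R : realType.
Implicit Types s : state R.

Fixpoint neval s (e : nexp) : nat :=
  match e with
  | NConst c => c
  | NCell a i => nmem s a (neval s i)
  | NAdd e1 e2 => (neval s e1 + neval s e2)%N
  | NSub e1 e2 => (neval s e1 - neval s e2)%N
  end.

Fixpoint reval s (e : rexp) : R :=
  match e with
  | RConst q => ratr q
  | RCell a i => rmem s a (neval s i)
  | RAdd e1 e2 => reval s e1 + reval s e2
  | RScale q e1 => ratr q * reval s e1
  end.

Fixpoint beval s (b : bexp) : bool :=
  match b with
  | NLe e1 e2 => (neval s e1 <= neval s e2)%N
  | RLe e1 e2 => reval s e1 <= reval s e2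
  | BNot b1 => ~~ beval s b1
  | BAnd b1 b2 => beval s b1 && beval s b2
  end.

(* The oracle takes a characteristic vector over arrival indices.  A
   configuration is the stack of commands still to be run and the state; the
   machine has halted when the stack is empty. *)
Definition step (oracle : pred nat -> R) (c : seq cmd * state R) :
    seq cmd * state R :=
  let: (stack, s) := c in
  match stack with
  | [::] => ([::], s)
  | Skip :: l => (l, s)
  | NSet a i e :: l =>
      (l, State (upd (nmem s) a (neval s i) (neval s e)) (rmem s) (tape s))
  | RSet a i e :: l =>
      (l, State (nmem s) (upd (rmem s) a (neval s i) (reval s e)) (tape s))
  | Query a i b :: l =>
      (l, State (nmem s)
            (upd (rmem s) a (neval s i) (oracle (fun j => nmem s b j != 0%N)))
            (tape s))
  | Flip a i :: l =>
      (l, State (upd (nmem s) a (neval s i) (nat_of_bool (tape s 0%N)))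
            (rmem s) (fun j => tape s j.+1))
  | Seq c1 c2 :: l => (c1 :: c2 :: l, s)
  | If b c1 c2 :: l => ((if beval s b then c1 else c2) :: l, s)
  | While b c1 :: l => if beval s b then (c1 :: While b c1 :: l, s) else (l, s)
  end.

Definition start (w : nat -> bool) : state R :=
  State (fun _ _ => 0%N) (fun _ _ => 0) w.

(* The t-th arrival announces k in cell 0 and t in cell 1 of natural array 0;
   all other memory persists from round to round. *)
Definition arrive (k t : nat) s : state R :=
  State (upd (upd (nmem s) 0 0 k) 0 1 t) (rmem s) (tape s).

End Machine.

Section Online.
Variables (R : realType) (n : nat) (X : finType).

(* x i is the (i+1)-st element to arrive; [select x t p] is the set of those
   among the first t elements whose arrival index satisfies p. *)
Definition select (x : 'I_n -> X) (t : nat) (p : pred nat) : {set X} :=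
  [set x i | i : 'I_n & (i < t)%N && p i].

Definition arrived (x : 'I_n -> X) (t : nat) : {set X} := select x t predT.

Definition nonneg_fun (f : {set X} -> R) : Prop := forall S, 0 <= f S.

Definition monotone_fun (f : {set X} -> R) : Prop :=
  forall S T : {set X}, S \subset T -> f S <= f T.

Definition submodular (f : {set X} -> R) : Prop :=
  forall S T : {set X}, f (S :|: T) + f (S :&: T) <= f S + f T.

Definition OPT (x : 'I_n -> X) (f : {set X} -> R) (k t : nat) : {set X} :=
  [arg max_(S > set0 | (S \subset arrived x t) && (#|S| <= k)%N) f S]%O.

Variables (x : 'I_n -> X) (f : {set X} -> R) (A : cmd) (k T : nat).

(* In round t the program is run from its beginning for T steps; only sets of
   elements that have arrived can be queried. *)
Definition round (t : nat) (s : state R) : seq cmd * state R :=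
  iter T (step (fun p => f (select x t p))) ([:: A], arrive k t s).

Fixpoint state_after (w : nat -> bool) (t : nat) : state R :=
  if t is t'.+1 then (round t (state_after w t')).2 else start R w.

(* When this holds, the runs below do not depend on the step budget T, as a
   halted configuration is a fixed point of [step]. *)
Definition halts_in_time : Prop :=
  forall (w : nat -> bool) (t : nat), (t < n)%N ->
    (round t.+1 (state_after w t)).1 = [::].

(* The solution is read off natural array 1 as a characteristic vector. *)
Definition ALG (w : nat -> bool) (t : nat) : {set X} :=
  select x t (fun i => nmem (state_after w t) 1 i != 0%N).

Definition feasible : Prop :=
  forall (w : nat -> bool) (t : nat), (t <= n)%N -> (#|ALG w t| <= k)%N.

Definition consistent (C : R) : Prop :=
  forall (w : nat -> bool) (t : nat), (t < n)%N ->
    #|ALG w t.+1 :\: ALG w t|%:R <= C.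

(* Expectation over fair bits of a quantity that reads at most the first m. *)
Definition expect (m : nat) (F : (nat -> bool) -> R) : R :=
  (\sum_(w : m.-tuple bool) F (nth false w)) / 2 ^+ m.

(* At most one bit is read per step, so at most n * T bits in n rounds. *)
Definition approximates (alpha : R) : Prop :=
  forall t : nat, (0 < t <= n)%N ->
    alpha * f (OPT x f k t) <= expect (n * T) (fun w => f (ALG w t)).

End Online.

(* Main.v *)
Require Import Defs.
From HB Require Import structures.
From mathcomp Require Import all_boot all_order all_algebra.
From mathcomp Require Import boolp reals.
From mathcomp Require Import zify lra.

Set Implicit Arguments.
Unset Strict Implicit.
Unset Printing Implicit Defensive.

Import Order.TTheory GRing.Theory Num.Theory.
Local Open Scope ring_scope.

(** Time is cut into epochs of about [eps k] rounds.  At the start [b] of an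
    epoch, run the greedy algorithm on the elements seen so far for [2 k']
    steps, where [k'] is [k] minus the length of an epoch.  Let [H] be the first
    [k'] picks and [G] the next [k'].  During the epoch the solution is [H] (with
    probability 29/32) or [G] (with probability 3/32), together with the set [N]
    of all elements that arrived after [b].

    Write [o = f(O|H)] for the part [O] of the optimum that was seen before [b].
    Greedy gives, up to [1 - eps], [f(H) >= f(O)/5 + 3o/4] and [f(G|H) >= o/2].
    Submodularity gives [f(O+N) <= f(H+N) + o], [f(O+N) <= f(O) + f(N)] and
    [f(H+N) + f(G+N) >= f(H+G) + f(N)].  A linear combination of these bounds the
    mean of [f(H+N)] and [f(G+N)] below by [0.51 f(O+N)], whatever [N] is.

    The old solution is dropped at the start of an epoch and the new one is
    inserted [O(1/eps^2)] elements at a time, which takes a fraction [eps] of the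
    epoch.  A random shift of the epochs makes any given round fall into this
    stretch with probability at most [eps].  A round recomputes its solution from
    [t], [k] and the seeds alone. *)

(** * Running programs *)

Section Wp.
Variables (R : realType) (orc : pred nat -> R).
Implicit Types (s : state R) (c : cmd) (Q : state R -> Prop) (N : nat).

(** Total correctness within [N] steps. Quantifying over the rest [l] of the stack lets runs be
    composed. *)
Definition wp c N Q s : Prop :=
  exists j s', [/\ (j <= N)%N,
    forall l, iter j (step orc) (c :: l, s) = (l, s') & Q s'].

Lemma wp_weaken c N N' Q Q' s :
  (N <= N')%N -> (forall s', Q s' -> Q' s') -> wp c N Q s -> wp c N' Q' s.
Proof.
move=> leN QQ' [j [s' [jN it Qs']]]; exists j, s'.
by split=> //; [exact: leq_trans jN leN | exact: QQ'].
Qed.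

Lemma wp_skip Q s : Q s -> wp Skip 1 Q s.
Proof. by move=> Qs; exists 1%N, s. Qed.

Lemma wp_nset a i e Q s :
  Q (State (upd (nmem s) a (neval s i) (neval s e)) (rmem s) (tape s)) ->
  wp (NSet a i e) 1 Q s.
Proof. by move=> Qs; exists 1%N; eexists; split; [|move=> l; reflexivity|]. Qed.

Lemma wp_rset a i e Q s :
  Q (State (nmem s) (upd (rmem s) a (neval s i) (reval s e)) (tape s)) ->
  wp (RSet a i e) 1 Q s.
Proof. by move=> Qs; exists 1%N; eexists; split; [|move=> l; reflexivity|]. Qed.

Lemma wp_query a i b Q s :
  Q (State (nmem s)
       (upd (rmem s) a (neval s i) (orc (fun j => nmem s b j != 0%N))) (tape s)) ->
  wp (Query a i b) 1 Q s.
Proof. by move=> Qs; exists 1%N; eexists; split; [|move=> l; reflexivity|]. Qed.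

Lemma wp_flip a i Q s :
  Q (State (upd (nmem s) a (neval s i) (tape s 0%N)) (rmem s)
       (fun j => tape s j.+1)) ->
  wp (Flip a i) 1 Q s.
Proof. by move=> Qs; exists 1%N; eexists; split; [|move=> l; reflexivity|]. Qed.

Lemma wp_seq c1 c2 N1 N2 Q s :
  wp c1 N1 (wp c2 N2 Q) s -> wp (Seq c1 c2) (N1 + N2).+1 Q s.
Proof.
move=> [j1 [s1 [jN1 it1 [j2 [s2 [jN2 it2 Qs2]]]]]].
exists (j2 + j1).+1, s2; split=> // [|l]; first by lia.
by rewrite iterSr iterD /= it1 it2.
Qed.

Lemma wp_if b c1 c2 N Q s :
  (beval s b -> wp c1 N Q s) -> (~~ beval s b -> wp c2 N Q s) ->
  wp (If b c1 c2) N.+1 Q s.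
Proof.
case: (boolP (beval s b)) => eb H1 H2.
  have [j [s' [jN it Qs']]] := H1 isT.
  by exists j.+1, s'; split=> // l; rewrite iterSr /= eb it.
have [j [s' [jN it Qs']]] := H2 isT.
by exists j.+1, s'; split=> // l; rewrite iterSr /= (negbTE eb) it.
Qed.

(** The loop runs exactly [J] times. Each round costs one test and at most [N] steps, and the
    failing test costs the final step. *)
Lemma wp_while b c (I : nat -> state R -> Prop) J N Q s :
  I 0%N s ->
  (forall i s', (i < J)%N -> I i s' -> beval s' b /\ wp c N (I i.+1) s') ->
  (forall s', I J s' -> ~~ beval s' b /\ Q s') ->
  wp (While b c) (J * N.+1).+1 Q s.
Proof.
move=> I0 IS IJ.
have loop d : forall i s', (i + d = J)%N -> I i s' ->
    wp (While b c) (d * N.+1).+1 Q s'.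
  elim: d => [|d IHd] i s' id Is'.
    rewrite addn0 in id; rewrite id in Is'; have [/negbTE nb Qs'] := IJ s' Is'.
    by exists 1%N, s'; split=> // l /=; rewrite nb.
  have [|eb [j1 [s1 [jN1 it1 Is1]]]] := IS i s' _ Is'; first by lia.
  have [|j2 [s2 [jN2 it2 Qs2]]] := IHd i.+1 s1 _ Is1; first by lia.
  exists (j2 + j1).+1, s2; split=> // [|l]; first by nia.
  by rewrite iterSr iterD /= eb it1 it2.
exact: loop I0.
Qed.

Lemma wp_halts c N Q s T : wp c N Q s -> (N <= T)%N ->
  exists2 s', iter T (step orc) ([:: c], s) = ([::], s') & Q s'.
Proof.
move=> [j [s' [jN it Qs']]] NT; exists s' => //.
have -> : T = (T - j + j)%N by lia.
by rewrite iterD it; elim: (T - j)%N => //= d ->.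
Qed.

End Wp.

(** * The program *)

Definition var (c : nat) : nexp := NCell 0 (NConst c).
Definition set_var (c : nat) (e : nexp) : cmd := NSet 0 (NConst c) e.
Definition nlt (e1 e2 : nexp) : bexp := NLe (NAdd e1 (NConst 1)) e2.
Definition incr (c : nat) : cmd := set_var c (NAdd (var c) (NConst 1)).

(** The language has no product, so multiplication by a constant fixed with the program is unrolled
    into additions. *)
Fixpoint nmul (c : nat) (e : nexp) : nexp :=
  if c is c'.+1 then NAdd e (nmul c' e) else NConst 0.

(** Horner's rule in base 2, the first bit being the most significant; cell 4 holds the bit just
    read. *)
Fixpoint flips (c n : nat) : cmd :=
  if n is n'.+1 then
    Seq (Flip 0 (NConst 4))
      (Seq (set_var c (NAdd (NAdd (var c) (var c)) (var 4))) (flips c n'))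
  else Skip.

(* Variables: 0 = k, 1 = t, 2 = seed of the window, 3 = seed of the shift,
   4 = scratch, 5 = length of a slot, 6 = length of an epoch, 7 = age of the
   epoch, 8 and 9 = bounds of the part of the greedy sequence that is kept,
   10 = length of the greedy sequence, 11 = start of the epoch,
   12 = greedy step, 13 = best candidate.  Array 2 holds the greedy set; real
   cells 0 and 1 hold the value of the best and of the current candidate. *)
Section Program.
Variables M m : nat.

Definition draw_seeds : cmd :=
  If (NLe (var 1) (NConst 1)) (Seq (flips 2 5) (flips 3 M)) Skip.

Definition take_all : cmd :=
  Seq (set_var 4 (NConst 0))
    (While (nlt (var 4) (var 1)) (Seq (NSet 1 (var 4) (NConst 1)) (incr 4))).

Definition slot_length : cmd :=
  Seq (set_var 5 (NConst 0))
    (While (NLe (nmul (m * m) (NAdd (var 5) (NConst 1))) (var 0)) (incr 5)).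

(** In truncated arithmetic [a + (1 - a)] is the maximum of [a] and 1, which keeps the epoch
    non-empty when [k < m * m]. The last loop reduces modulo the epoch by repeated subtraction. *)
Definition epoch_age : cmd :=
  Seq (set_var 6 (NAdd (nmul m (var 5)) (NSub (NConst 1) (nmul m (var 5)))))
  (Seq (set_var 7 (var 1))
  (Seq (set_var 4 (NConst 0))
  (Seq (While (nlt (var 4) (var 3))
          (Seq (set_var 7 (NAdd (var 7) (var 5))) (incr 4)))
       (While (NLe (var 6) (var 7)) (set_var 7 (NSub (var 7) (var 6))))))).

Definition window_size : nexp := NSub (var 0) (nmul m (var 5)).

(** Three of the 32 window seeds select [G]. The form [p - (p - q)] is the minimum of [p] and [q]:
    the window opens by [m * m] picks per round until it is complete. *)
Definition bounds : cmd :=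
  Seq (If (NLe (var 2) (NConst 2)) (set_var 8 window_size)
         (set_var 8 (NConst 0)))
  (Seq (set_var 9 (nmul (m * m) (NAdd (var 7) (NConst 1))))
  (Seq (set_var 9 (NAdd (var 8) (NSub (var 9) (NSub (var 9) window_size))))
  (Seq (set_var 10 (NAdd window_size window_size))
       (set_var 11 (NSub (var 1) (var 7)))))).

Definition clear : cmd :=
  Seq (set_var 4 (NConst 0))
    (While (nlt (var 4) (var 1))
      (Seq (NSet 2 (var 4) (NConst 0))
      (Seq (If (NLe (var 11) (var 4)) (NSet 1 (var 4) (NConst 1))
              (NSet 1 (var 4) (NConst 0)))
           (incr 4)))).

(** Adding 1 to a mark and subtracting it again restores the mark even when the candidate already
    belongs to the greedy set. *)
Definition scan_candidates : cmd :=
  Seq (set_var 4 (NConst 0))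
  (Seq (set_var 13 (NConst 0))
  (Seq (RSet 0 (NConst 0) (RConst 0))
    (While (nlt (var 4) (var 11))
      (Seq (NSet 2 (var 4) (NAdd (NCell 2 (var 4)) (NConst 1)))
      (Seq (Query 0 (NConst 1) 2)
      (Seq (NSet 2 (var 4) (NSub (NCell 2 (var 4)) (NConst 1)))
      (Seq (If (RLe (RCell 0 (NConst 0)) (RCell 0 (NConst 1)))
              (Seq (RSet 0 (NConst 0) (RCell 0 (NConst 1)))
                   (set_var 13 (var 4)))
              Skip)
           (incr 4)))))))).

Definition greedy_loop : cmd :=
  Seq (set_var 12 (NConst 0))
    (While (nlt (var 12) (var 10))
      (Seq scan_candidates
      (Seq (NSet 2 (var 13) (NConst 1))
      (Seq (If (BAnd (NLe (var 8) (var 12)) (nlt (var 12) (var 9)))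
              (NSet 1 (var 13) (NConst 1)) Skip)
           (incr 12))))).

Definition main : cmd :=
  Seq draw_seeds
    (If (NLe (var 1) (var 0)) take_all
      (Seq slot_length (Seq epoch_age (Seq bounds (Seq clear greedy_loop))))).

End Program.

(** * Greedy sequences *)

Section Submodular.
Variables (R : realType) (X : finType) (f : {set X} -> R).
Hypotheses (fmono : monotone_fun f) (fsub : submodular f).
Implicit Types A B O N : {set X}.

(** Submodularity is applied to [O :|: A] and [B], whose intersection contains [A]. *)
Lemma submodular_marginal A B O : A \subset B ->
  f (O :|: B) - f B <= f (O :|: A) - f A.
Proof.
move=> AB; have := fsub (O :|: A) B.
have -> : (O :|: A) :|: B = O :|: B by rewrite -setUA (setUidPr AB).
have : f A <= f ((O :|: A) :&: B) by apply: fmono; rewrite subsetI subsetUr.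
lra.
Qed.

Lemma marginal_card A O (d : R) :
  (forall y, y \in O -> f (y |: A) - f A <= d) ->
  f (O :|: A) - f A <= #|O|%:R * d.
Proof.
move cO: #|O| => c; elim: c O cO => [|c IHc] O cO Od.
  by rewrite (cards0_eq cO) set0U mul0r subrr.
have /card_gt0P[y yO] : (0 < #|O|)%N by rewrite cO.
have cO' : #|O :\ y| = c by move: cO; rewrite (cardsD1 y) yO; case.
have {}IHc := IHc _ cO' (fun z zO => Od z (subsetP (subsetDl _ _) z zO)).
have := submodular_marginal [set y] (subsetUr (O :\ y) A).
rewrite setUA setD1K //; have := Od y yO.
rewrite -natr1 mulrDl mul1r; lra.
Qed.

Section Sequence.
Variables (Y : {set X}) (A : nat -> {set X}).
Hypothesis sub_step : forall j, A j \subset A j.+1.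
Hypothesis best_step : forall j y, y \in Y -> f (y |: A j) <= f (A j.+1).

Lemma greedy_subset i j : (i <= j)%N -> A i \subset A j.
Proof.
move/subnK <-; elim: (j - i)%N => [|d IHd]; first by rewrite add0n.
by apply: subset_trans IHd _; rewrite addSn.
Qed.

Variables (O : {set X}) (k : nat).
Hypotheses (OY : O \subset Y) (Ok : (#|O| <= k)%N).

(** Step [i] gains at least as much as any single element of [O] would, and the marginal value of
    [O] only shrinks from [i] to [j]. *)
Lemma greedy_gain i j : (i <= j)%N ->
  f (O :|: A j) - f (A j) <= k%:R * (f (A i.+1) - f (A i)).
Proof.
move=> ij; apply: le_trans (submodular_marginal O (greedy_subset ij)) _.
have d0 : 0 <= f (A i.+1) - f (A i) by rewrite subr_ge0; exact: fmono.
apply: (@le_trans _ _ (#|O|%:R * (f (A i.+1) - f (A i)))).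
  apply: marginal_card => y yO; rewrite lerD2r; apply: best_step.
  exact: (subsetP OY).
by apply: ler_wpM2r => //; rewrite ler_nat.
Qed.

Lemma greedy_linear i d :
  d%:R * (f (O :|: A (i + d)%N) - f (A (i + d)%N)) <=
  k%:R * (f (A (i + d)%N) - f (A i)).
Proof.
set o := _ - f (A (i + d)%N).
suff H e : (e <= d)%N -> e%:R * o <= k%:R * (f (A (i + e)%N) - f (A i)).
  exact: H.
elim: e => [|e IHe] ed; first by rewrite addn0 mul0r subrr mulr0.
have := @greedy_gain (i + e) (i + d) ltac:(lia); have := IHe (ltnW ed).
rewrite -/o addnS -natr1 mulrDl mul1r !mulrBr; lra.
Qed.

(* Each of the first [kap] steps gains at least [o/k], and [4/5 f(O)/k] as long
   as the current value is below [f(O)/5]. *)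
Lemma greedy_value (kap : nat) :
  0 <= f (A 0) -> (kap <= k)%N ->
  kap%:R * (f O / 5 + 3 / 4 * (f (O :|: A kap) - f (A kap))) <=
  k%:R * f (A kap).
Proof.
set o := f (O :|: A kap) - _; move=> A0 kapk.
have gain1 i : (i <= kap)%N -> o <= k%:R * (f (A i.+1) - f (A i)).
  exact: greedy_gain.
have gain2 i : f O - f (A i) <= k%:R * (f (A i.+1) - f (A i)).
  apply: le_trans (greedy_gain (leqnn i)); rewrite lerD2r.
  exact/fmono/subsetUl.
have kpos : 0 <= k%:R :> R by [].
have kapR : kap%:R <= k%:R :> R by rewrite ler_nat.
have kap0 : 0 <= kap%:R :> R by [].
have f0 i : 0 <= f (A i) by apply: le_trans A0 _; apply/fmono/greedy_subset.
(* If the remaining marginal is this large, the linear bound suffices: [o / 4] pays for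
   [f O / 5]. *)
have [o45|o45] := leP (4 / 5 * f O) o.
  have := greedy_linear 0 kap; rewrite add0n -/o.
  have : 0 <= k%:R * f (A 0) by exact: mulr_ge0.
  have : kap%:R * (f O / 5) <= kap%:R * (o / 4) by apply: ler_wpM2l => //; lra.
  lra.
(* Two phases: up to the value [f O / 5] every step gains [4 / 5 * f O / k], and afterwards only
   [o / k] is claimed. At [i = kap] either alternative gives the goal. *)
have Hi i : (i <= kap)%N ->
    i%:R * (4 / 5 * f O) <= k%:R * f (A i) \/
    kap%:R * (f O / 5) + (i%:R - kap%:R / 4) * o <= k%:R * f (A i).
  elim: i => [|i IHi] ik; first by left; rewrite mul0r mulr_ge0.
  have g1 := gain1 i (ltnW ik); have g2 := gain2 i.
  rewrite -natr1.
  have [H|H] := IHi (ltnW ik); last by right; lra.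
  have [small|big] := leP (f (A i)) (f O / 5); first by left; lra.
  right.
  have kbig : k%:R * (f O / 5) <= k%:R * f (A i) by apply: ler_wpM2l => //; lra.
  have fO0 : kap%:R * (f O / 5) <= k%:R * f (A i).
    have [fO|fO] := leP 0 (f O).
      by apply: le_trans kbig; apply: ler_wpM2r => //; lra.
    apply: (@le_trans _ _ 0); last exact: mulr_ge0.
    by rewrite nmulr_lle0 //; lra.
  (* The phase changes here. A late change trades [o] for the larger [4 / 5 * f O] in the first
     bound; an early one relies on the value already exceeding [f O / 5]. *)
  have [ile|ige] := leP (i%:R : R) (kap%:R / 4); last first.
    have : (i%:R - kap%:R / 4) * o <= (i%:R - kap%:R / 4) * (4 / 5 * f O).
      by apply: ler_wpM2l; lra.
    lra.
  have o0 : 0 <= o by rewrite subr_ge0; exact/fmono/subsetUr.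
  have : (kap%:R / 4 - i%:R) * o >= 0 by apply: mulr_ge0; lra.
  lra.
have [H|H] := Hi kap (leqnn _); last by lra.
have : kap%:R * o <= kap%:R * (4 / 5 * f O) by apply: ler_wpM2l => //; lra.
lra.
Qed.

(* [H] and [G] cannot both be useless next to [N]: if [N] makes [H] redundant,
   then [N] is itself valuable and [G] adds to it. *)
Lemma two_windows (kap m : nat) (G N : {set X}) :
  nonneg_fun f -> (0 < k)%N -> (kap <= k)%N -> (0 < m)%N ->
  (m * (k - kap) <= k)%N -> A kap :|: G = A (kap + kap)%N ->
  (51 / 100 - 1 / m%:R) * f (O :|: N) <=
  (29 * f (A kap :|: N) + 3 * f (G :|: N)) / 32.
Proof.
move=> fpos k0 kapk m0 mk AG.
set H := A kap; set o := f (O :|: H) - f H.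
set g := f (A (kap + kap)%N) - f H.
have Hval := greedy_value (fpos _) kapk; rewrite -/H -/o in Hval.
have gval := greedy_linear kap kap; rewrite -/g in gval.
have g0 : 0 <= g by rewrite subr_ge0; apply/fmono/greedy_subset/leq_addr.
have fOO : f (O :|: H) <= f (O :|: A (kap + kap)%N).
  by apply: fmono; rewrite setUS // greedy_subset // leq_addr.
have ole : o <= f O by have := submodular_marginal O (sub0set H);
  rewrite setU0 -/o; have := fpos set0; lra.
have o0 : 0 <= o by rewrite subr_ge0; exact/fmono/subsetUr.
have HN : f H <= f (H :|: N) by exact/fmono/subsetUl.
have FG : f H + g + f N <= f (H :|: N) + f (G :|: N).
  have := fsub (H :|: N) (G :|: N).
  have : f N <= f ((H :|: N) :&: (G :|: N)).
    by apply: fmono; rewrite subsetI !subsetUr.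
  have : f (A (kap + kap)%N) <= f ((H :|: N) :|: (G :|: N)).
    by apply: fmono; rewrite -AG setUACA subsetUl.
  rewrite /g; lra.
have Zle : f (O :|: N) <= f (H :|: N) + o.
  have := submodular_marginal O (subsetUl H N).
  have : f (O :|: N) <= f (O :|: (H :|: N)) by apply/fmono/setUS/subsetUr.
  rewrite -/o; lra.
have Nge : f (O :|: N) <= f O + f N.
  by have := fsub O N; have := fpos (O :&: N); lra.
have OZ : f O <= f (O :|: N) by exact/fmono/subsetUl.
have fO0 := fpos O.
(* The greedy bounds carry the factor [rho], which is within [1 / m] of 1. In [a2] and [g2] this
   loss becomes an additive error [e * f O]. *)
pose rho : R := kap%:R / k%:R.
have kR : 0 < k%:R :> R by rewrite ltr0n.
have mR : 0 < m%:R :> R by rewrite ltr0n.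
have rho1 : rho <= 1 by rewrite ler_pdivrMr // mul1r ler_nat.
have rhom : 1 - 1 / m%:R <= rho.
  rewrite lerBlDr -lerBlDl lter_pdivlMr //.
  have -> : 1 - rho = (k - kap)%:R / k%:R.
    by rewrite natrB // /rho mulrBl divff ?gt_eqF.
  by rewrite mulrAC ler_pdivrMr // mul1r -natrM ler_nat mulnC.
have aval : rho * (f O / 5 + 3 / 4 * o) <= f H.
  by rewrite /rho mulrAC ler_pdivrMr // [f H * _]mulrC.
have {}gval : rho * (o - g) <= g.
  rewrite /rho mulrAC ler_pdivrMr // [g * _]mulrC.
  by apply: le_trans gval; apply: ler_wpM2l => //; rewrite /g /o; lra.
have rho0 : 0 <= rho by rewrite divr_ge0.
set e := 1 / m%:R in rhom *.
set Z := f (O :|: N) in Zle Nge OZ *.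
clearbody rho e Z o g.
have Z0 : 0 <= Z by lra.
have a2 : f O / 5 + 3 / 4 * o - f H <= e * f O.
  have : (1 - rho) * (f O / 5 + 3 / 4 * o) <= e * f O.
    apply: ler_pM; lra.
  lra.
have e0 : 0 <= e * f O by apply: mulr_ge0 => //; lra.
have g2 : o / 2 - g <= e * f O.
  have [|og] := leP (o / 2) g.
    lra.
  have : (1 - rho) * (o - g) <= e * f O by apply: ler_pM; lra.
  lra.
(* One certificate for the goal times 32: 3 copies of [FG] and [Nge], 12.68 of [HN], 13.32 of [Zle],
   15.68 of [a2] and 3 of [g2]. What remains is [0.136 f O - 0.06 o], non-negative by [ole], and the
   error [18.68 e * f O] is below [32 e * Z]. *)
have : e * f O <= e * Z by apply: ler_wpM2l => //; lra.
lra.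
Qed.

End Sequence.
End Submodular.

(** * Specification and verification of the program *)

Section Spec.
Variables (R : realType) (n : nat) (X : finType) (x : 'I_n -> X).
Variable f : {set X} -> R.

Definition elems (l : seq nat) : {set X} := [set x i | i : 'I_n & (i : nat) \in l].

(** The comparison is not strict, so a tie goes to the later index, as in the program. *)
Fixpoint scan (l : seq nat) (i : nat) : R * nat :=
  if i is i'.+1 then
    let w := f (elems (i' :: l)) in
    if (scan l i').1 <= w then (w, i') else scan l i'
  else (0, 0%N).

Fixpoint picks (b j : nat) : seq nat :=
  if j is j'.+1 then (scan (picks b j') b).2 :: picks b j' else [::].

Definition pick_at (b j : nat) : nat := (scan (picks b j) b).2.

Lemma scan_lt l i : (0 < i)%N -> ((scan l i).2 < i)%N.
Proof.
elim: i => // -[|i] IHi _ /=; first by case: ifP.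
by case: ifP => //= _; exact: ltnW (IHi isT).
Qed.

Lemma pick_lt b j : (0 < b)%N -> (pick_at b j < b)%N.
Proof. exact: scan_lt. Qed.

Lemma picks_lt b j i : (0 < b)%N -> i \in picks b j -> (i < b)%N.
Proof.
move=> b0; elim: j => //= j IHj; rewrite inE => /orP[/eqP->|//].
exact: scan_lt.
Qed.

Variables (m k t u r : nat).

Definition slot := (k %/ (m * m))%N.
Definition epoch := (m * slot + (1 - m * slot))%N.
Definition age := ((t + r * slot) %% epoch)%N.
Definition wsize := (k - m * slot)%N.
Definition lo := if (u <= 2)%N then wsize else 0%N.
Definition hi := (lo + (m * m * (age + 1) - (m * m * (age + 1) - wsize)))%N.

Definition kept (b j i : nat) : bool :=
  has (fun l => (lo <= l < hi)%N && (pick_at b l == i)) (iota 0 j).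

Definition alg (i : nat) : bool :=
  (t <= k)%N || ((t - age <= i)%N || kept (t - age) (wsize + wsize) i).

Lemma kept_step b j i : kept b j.+1 i =
  if i == pick_at b j then (lo <= j < hi)%N || kept b j i else kept b j i.
Proof.
rewrite /kept -[in iota 0 j.+1]addn1 iotaD add0n has_cat /= orbF eq_sym orbC.
by case: eqP => _; rewrite ?andbT ?andbF ?orFb.
Qed.

End Spec.

(** * Invariants on the memory of the machine *)

Section Invariant.
Variables (R : realType) (t : nat).
Implicit Types (s : state R) (vs : seq nat) (a b : pred nat).

(** The arrays matter only below [t], because [select x t] ignores later indices, and only up to
    being non-zero. *)
Definition inv s vs a1 a2 : Prop :=
  [/\ [seq nmem s 0 c | c <- iota 0 14] = vs,
      forall i, (i < t)%N -> (nmem s 1 i != 0%N) = a1 i &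
      forall i, (i < t)%N -> (nmem s 2 i != 0%N) = a2 i].

Lemma inv_read s vs a1 a2 c : inv s vs a1 a2 -> (c < 14)%N ->
  nmem s 0 c = nth 0%N vs c.
Proof.
by case=> <- _ _ c14; rewrite (nth_map 0%N) ?size_iota // nth_iota.
Qed.

Lemma inv_scalar s vs a1 a2 c v rm tp : inv s vs a1 a2 -> (c < 14)%N ->
  inv (State (upd (nmem s) 0 c v) rm tp) (set_nth 0%N vs c v) a1 a2.
Proof.
move=> I c14; have [<- H1 H2] := I; split=> //.
apply: (@eq_from_nth _ 0%N) => [|i].
  by rewrite size_set_nth !size_map size_iota; apply/esym/maxn_idPr.
rewrite size_map size_iota => i14.
rewrite nth_set_nth (nth_map 0%N) ?size_iota // nth_iota // add0n.
have [-> _ _] := I; rewrite /= -(inv_read I i14) /upd /=.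
by [].
Qed.

Lemma inv_ext s s' vs a1 a2 b1 b2 : nmem s' = nmem s ->
  (forall i, (i < t)%N -> a1 i = b1 i) -> (forall i, (i < t)%N -> a2 i = b2 i) ->
  inv s vs a1 a2 -> inv s' vs b1 b2.
Proof.
move=> es e1 e2 [H0 H1 H2]; rewrite /inv es; split=> // i it.
  by rewrite H1 ?e1.
by rewrite H2 ?e2.
Qed.

Lemma inv_array1 s vs a1 a2 b1 j v rm tp : inv s vs a1 a2 ->
  (forall i, (i < t)%N -> b1 i = if i == j then v != 0%N else a1 i) ->
  inv (State (upd (nmem s) 1 j v) rm tp) vs b1 a2.
Proof.
move=> [H0 H1 H2] eb; split=> //= i it.
by rewrite /upd /= eb //; case: (i =P j) => // _; exact: H1.
Qed.

Lemma inv_array2 s vs a1 a2 b2 j v rm tp : inv s vs a1 a2 ->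
  (forall i, (i < t)%N -> b2 i = if i == j then v != 0%N else a2 i) ->
  inv (State (upd (nmem s) 2 j v) rm tp) vs a1 b2.
Proof.
move=> [H0 H1 H2] eb; split=> //= i it.
by rewrite /upd /= eb //; case: (i =P j) => // _; exact: H2.
Qed.

Variable orc : pred nat -> R.

Lemma wp_set_var c e v vs a1 a2 Q s :
  inv s vs a1 a2 -> (c < 14)%N -> neval s e = v ->
  (forall s', inv s' (set_nth 0%N vs c v) a1 a2 -> rmem s' = rmem s -> Q s') ->
  wp orc (set_var c e) 1 Q s.
Proof. by move=> I c14 <- H; apply: wp_nset; apply: H => //; exact: inv_scalar. Qed.

Lemma wp_set_array1 ie e i v vs a1 a2 b1 Q s :
  inv s vs a1 a2 -> neval s ie = i -> neval s e = v ->
  (forall j, (j < t)%N -> b1 j = if j == i then v != 0%N else a1 j) ->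
  (forall s', inv s' vs b1 a2 -> Q s') -> wp orc (NSet 1 ie e) 1 Q s.
Proof.
by move=> I <- <- eb H; apply: wp_nset; apply: H => //; exact: inv_array1 I eb.
Qed.

Lemma wp_set_array2 ie e i v vs a1 a2 b2 Q s :
  inv s vs a1 a2 -> neval s ie = i -> neval s e = v ->
  (forall j, (j < t)%N -> b2 j = if j == i then v != 0%N else a2 j) ->
  (forall s', inv s' vs a1 b2 -> Q s') -> wp orc (NSet 2 ie e) 1 Q s.
Proof.
by move=> I <- <- eb H; apply: wp_nset; apply: H => //; exact: inv_array2 I eb.
Qed.

Lemma neval_nmul s c e : neval s (nmul c e) = (c * neval s e)%N.
Proof. by elim: c => //= c ->; rewrite mulSn. Qed.

End Invariant.

Arguments wp_set_var {R t orc c e} v {vs a1 a2 Q s}.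
Arguments wp_set_array1 {R t orc ie e} i v {vs a1 a2} b1 {Q s}.
Arguments wp_set_array2 {R t orc ie e} i v {vs a1 a2} b2 {Q s}.

Ltac rd I := rewrite /= ?neval_nmul /= ?(inv_read I) //=.

(** * Correctness and running time of one round *)

Section Verify.
Variables (R : realType) (n : nat) (X : finType) (x : 'I_n -> X).
Variable f : {set X} -> R.
Variables (m k t u r : nat).
Hypothesis m0 : (0 < m)%N.

Let orc := (fun p => f (select x t p)).
Notation inv := (@inv R t).
Notation wp := (wp orc).

Lemma wp_take_all g4 l a1 a2 s :
  inv s [:: k, t, u, r, g4 & l] a1 a2 ->
  wp take_all (4 * t + 3)
    (fun s' => inv s' [:: k, t, u, r, t & l] predT a2) s.
Proof.
move=> I; have -> : (4 * t + 3 = (1 + (t * 4).+1).+1)%N by lia.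
apply: wp_seq; apply: (wp_set_var 0%N I) => // s1 I1 _ /=.
pose J i s' := inv s' [:: k, t, u, r, i & l] (fun j => (j < i)%N || a1 j) a2.
apply: (wp_while (I := J)) => [|i s2 it I2|s2 I2].
- exact: (inv_ext _ _ _ I1).
- split; first by rd I2; lia.
  apply: (@wp_seq _ _ _ _ 1 1).
  apply: (wp_set_array1 i 1%N (fun j => (j < i.+1)%N || a1 j) I2) => //.
  + by rd I2.
  + by move=> j jt; rewrite ltnS leq_eqVlt; case: (j =P i).
  by move=> s3 I3; apply: (wp_set_var i.+1 I3) => //; rd I3; rewrite addn1.
- split; first by rd I2; lia.
  by apply: (inv_ext _ _ _ I2) => // j jt; rewrite jt.
Qed.

Lemma wp_slot_length g4 g5 l a1 a2 s : (k < t)%N ->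
  inv s [:: k, t, u, r, g4, g5 & l] a1 a2 ->
  wp (slot_length m) (2 * t + 3)
    (fun s' => inv s' [:: k, t, u, r, g4, slot m k & l] a1 a2) s.
Proof.
move=> kt I.
have mm0 : (0 < m * m)%N by rewrite muln_gt0 m0.
have slk : (slot m k <= k)%N by exact: leq_div.
apply: (@wp_weaken _ _ _ (1 + (slot m k * 2).+1).+1 _ _ _ _ _ (fun _ => id)).
  by lia.
apply: wp_seq; apply: (wp_set_var 0%N I) => // s1 I1 _ /=.
pose J i s' := inv s' [:: k, t, u, r, g4, i & l] a1 a2.
apply: (wp_while (I := J)) => [|i s2 it I2|s2 I2] //.
- split; last by apply: (wp_set_var i.+1 I2) => //; rd I2; rewrite addn1.
  by rd I2; rewrite addn1 mulnC -leq_divRL.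
- split; last by [].
  by rd I2; rewrite addn1 mulnC -leq_divRL // -ltnNge.
Qed.

Lemma slot_bound : (m * slot m k <= k)%N.
Proof.
apply: leq_trans (leq_trunc_div k (m * m)); rewrite mulnC leq_mul2l.
by rewrite leq_pmull // orbT.
Qed.

Lemma epoch_gt0 : (0 < epoch m k)%N.
Proof. by rewrite /epoch; lia. Qed.

Lemma wp_epoch_age g4 g6 g7 l a1 a2 s : (k < t)%N -> (r <= m)%N ->
  inv s [:: k, t, u, r, g4, slot m k, g6, g7 & l] a1 a2 ->
  wp (epoch_age m) (4 * m + 4 * t + 9)
    (fun s' => inv s'
      [:: k, t, u, r, r, slot m k, epoch m k, age m k t r & l] a1 a2) s.
Proof.
move=> kt rm I.
set d := slot m k in I *; set e := epoch m k.
have rk : (r * d <= k)%N.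
  by apply: leq_trans slot_bound; rewrite leq_mul2r rm orbT.
have ep0 := epoch_gt0; rewrite -/e in ep0.
pose q := ((t + r * d) %/ e)%N.
have qle : (q <= t + r * d)%N by exact: leq_div.
have div_q := divn_eq (t + r * d) e; rewrite -/q -/(age m k t r) in div_q.
have age_lt : (age m k t r < e)%N by exact: ltn_pmod.
(* The subtraction loop runs [q < 2 * t] times, because the epoch is positive and
   [r * d <= k < t]. *)
apply: (@wp_weaken _ _ _ (1 + (1 + (1 + ((r * 4).+1 + (q * 2).+1).+1).+1).+1).+1
   _ _ _ _ _ (fun _ => id)); first by lia.
apply: wp_seq; apply: (wp_set_var e I) => // [|s1 I1 _ /=]; first by rd I.
apply: wp_seq; apply: (wp_set_var t I1) => // [|s2 I2 _ /=]; first by rd I1.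
apply: wp_seq; apply: (wp_set_var 0%N I2) => // s3 I3 _ /=.
apply: wp_seq.
pose J i s' := inv s' [:: k, t, u, r, i, d, e, (t + i * d)%N & l] a1 a2.
apply: (wp_while (I := J)) => [|i s4 it I4|s4 I4].
- by rewrite /J mul0n addn0.
- split; first by rd I4; lia.
  apply: (@wp_seq _ _ _ _ 1 1).
  apply: (wp_set_var (t + i.+1 * d)%N I4) => // [|s5 I5 _ /=].
    by rd I4; rewrite mulSn; lia.
  by apply: (wp_set_var i.+1 I5) => //; rd I5; rewrite addn1.
- split; first by rd I4; lia.
pose J' i s' := inv s' [:: k, t, u, r, r, d, e, (t + r * d - i * e)%N & l] a1 a2.
apply: (wp_while (I := J')) => [|i s5 it I5|s5 I5].
- by rewrite /J' mul0n subn0.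
- have ile : (i.+1 * e <= q * e)%N by rewrite leq_mul2r it orbT.
  rewrite mulSn in ile.
  split; first by rd I5; lia.
  apply: (wp_set_var (t + r * d - i.+1 * e)%N I5) => //.
  by rd I5; rewrite mulSn; lia.
- have eqa : (t + r * d - q * e = age m k t r)%N by lia.
  rewrite /J' eqa in I5; split=> //.
  by rd I5; lia.
Qed.

Lemma wp_bounds g4 g6 g8 g9 g10 g11 l a1 a2 s :
  inv s [:: k, t, u, r, g4, slot m k, g6, age m k t r, g8, g9, g10, g11 & l]
    a1 a2 ->
  wp (bounds m) 10
    (fun s' => inv s'
      [:: k, t, u, r, g4, slot m k, g6, age m k t r, lo m k u, hi m k t u r,
          (wsize m k + wsize m k)%N, (t - age m k t r)%N & l] a1 a2) s.
Proof.
move=> I; apply: (@wp_seq _ _ _ _ 2 7).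
pose Q s' := inv s' [:: k, t, u, r, g4, slot m k, g6, age m k t r, lo m k u,
  g9, g10, g11 & l] a1 a2.
apply: (@wp_weaken _ _ _ 2 _ Q) => // [s1 I1|].
  apply: (@wp_seq _ _ _ _ 1 5).
  apply: (wp_set_var (m * m * (age m k t r + 1))%N I1) => // [|s2 I2 _ /=].
    by rd I1.
  apply: (@wp_seq _ _ _ _ 1 3).
  apply: (wp_set_var (hi m k t u r) I2) => // [|s3 I3 _ /=]; first by rd I2.
  apply: (@wp_seq _ _ _ _ 1 1).
  apply: (wp_set_var (wsize m k + wsize m k)%N I3) => // [|s4 I4 _ /=].
    by rd I3.
  by apply: (wp_set_var (t - age m k t r)%N I4) => //; rd I4.
apply: wp_if => /=; rd I => u2; apply: (wp_set_var (lo m k u) I) => //; rd I.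
  by rewrite /lo u2.
by rewrite /lo (negbTE u2).
Qed.

Lemma wp_clear g4 d1 d2 d3 d4 d5 d6 b l a1 a2 s :
  inv s [:: k, t, u, r, g4, d1, d2, d3, d4, d5, d6, b & l] a1 a2 ->
  wp clear (7 * t + 3)
    (fun s' => inv s' [:: k, t, u, r, t, d1, d2, d3, d4, d5, d6, b & l]
      (fun i => (b <= i)%N) pred0) s.
Proof.
move=> I; have -> : (7 * t + 3 = (1 + (t * 7).+1).+1)%N by lia.
apply: wp_seq; apply: (wp_set_var 0%N I) => // s1 I1 _ /=.
pose c1 i j := if (j < i)%N then (b <= j)%N else a1 j.
pose c2 i j := if (j < i)%N then false else a2 j.
pose J i s' := inv s' [:: k, t, u, r, i, d1, d2, d3, d4, d5, d6, b & l]
  (c1 i) (c2 i).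
apply: (wp_while (I := J)) => [|i s2 it I2|s2 I2].
- exact: (inv_ext _ _ _ I1).
- split; first by rd I2; lia.
  apply: (@wp_seq _ _ _ _ 1 4).
  apply: (wp_set_array2 i 0%N (c2 i.+1) I2); rd I2.
    by move=> j jt; rewrite /c2 ltnS leq_eqVlt; case: (j =P i).
  move=> s3 I3; apply: (@wp_seq _ _ _ _ 2 1).
  pose Q s' := inv s' [:: k, t, u, r, i, d1, d2, d3, d4, d5, d6, b & l]
    (c1 i.+1) (c2 i.+1).
  apply: (@wp_weaken _ _ _ 2 _ Q) => // [s4 I4|].
    by apply: (wp_set_var i.+1 I4) => //; rd I4; rewrite addn1.
  apply: wp_if => /=; rd I3 => bi.
    apply: (wp_set_array1 i 1%N (c1 i.+1) I3) => //; rd I3.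
    by move=> j jt; rewrite /c1 ltnS leq_eqVlt; case: (j =P i) => // ->.
  apply: (wp_set_array1 i 0%N (c1 i.+1) I3) => //; rd I3.
  move=> j jt; rewrite /c1 ltnS leq_eqVlt; case: (j =P i) => // ->.
  by rewrite (negbTE bi).
- split; first by rd I2; lia.
  by apply: (inv_ext _ _ _ I2) => // j jt; rewrite /c1 /c2 jt.
Qed.

(** Translates the characteristic vector sent to the oracle into the list form used by [scan]. *)
Lemma select_elems (p : pred nat) l :
  (forall j, (j < t)%N -> p j = (j \in l)) -> {in l, forall j, (j < t)%N} ->
  select x t p = elems x l.
Proof.
move=> pl lt; apply/setP => y.
apply/imsetP/imsetP => -[i]; rewrite inE => Hi ->; exists i => //; rewrite inE.
  by case/andP: Hi => it; rewrite pl.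
by have it := lt _ Hi; rewrite it pl.
Qed.

Lemma wp_scan g4 d1 d2 d3 d4 d5 d6 b d7 g13 a1 L s :
  (b <= t)%N -> {in L, forall j, (j < b)%N} ->
  inv s [:: k; t; u; r; g4; d1; d2; d3; d4; d5; d6; b; d7; g13] a1 (fun j => j \in L) ->
  wp scan_candidates (13 * t + 7)
    (fun s' => inv s' [:: k; t; u; r; b; d1; d2; d3; d4; d5; d6; b; d7;
                          (scan x f L b).2] a1 (fun j => j \in L)) s.
Proof.
move=> bt Lb I.
apply: (@wp_weaken _ _ _ (1 + (1 + (1 + (b * 13).+1).+1).+1).+1 _ _ _ _ _
  (fun _ => id)); first by lia.
apply: wp_seq; apply: (wp_set_var 0%N I) => // s1 I1 _ /=.
apply: wp_seq; apply: (wp_set_var 0%N I1) => // s2 I2 _ /=.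
apply: wp_seq; apply: wp_rset => /=.
pose J i s' := inv s' [:: k; t; u; r; i; d1; d2; d3; d4; d5; d6; b; d7;
    (scan x f L i).2] a1 (fun j => j \in L) /\ rmem s' 0%N 0%N = (scan x f L i).1.
apply: (wp_while (I := J)) => [|i s3 ib [I3 v3]|s3 [I3 v3]].
- by split; [exact: (inv_ext _ _ _ I2) | rewrite /upd /= rmorph0].
- have it : (i < t)%N by lia.
  split; first by rd I3; lia.
  apply: (@wp_seq _ _ _ _ 1 10); apply: wp_nset.
  set sA := State _ _ _.
  have IA : inv sA [:: k; t; u; r; i; d1; d2; d3; d4; d5; d6; b; d7;
      (scan x f L i).2] a1 (fun j => j \in i :: L).
    apply: (inv_array2 _ _ I3) => j jt; rewrite /= (inv_read I3) //= addn1 inE.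
    by case: eqP.
  apply: (@wp_seq _ _ _ _ 1 8); apply: wp_query => /=.
  have -> : orc (fun j => upd (nmem s3) 2 (nmem s3 0 4)
      (nmem s3 2 (nmem s3 0 4) + 1)%N 2 j != 0%N) = f (elems x (i :: L)).
    congr f; apply: select_elems => [j jt|j].
      by have [_ _ HA] := IA; exact: HA.
    by rewrite inE => /orP[/eqP->//|/Lb jb]; exact: leq_trans jb bt.
  apply: (@wp_seq _ _ _ _ 1 6); apply: wp_nset => /=.
  set sB := State _ _ _.
  have IB : inv sB [:: k; t; u; r; i; d1; d2; d3; d4; d5; d6; b; d7;
      (scan x f L i).2] a1 (fun j => j \in L).
    rewrite /sB; apply: (inv_array2 _ _ IA) => j jt.
    rewrite /upd /= (inv_read I3) //= eqxx /= addnK.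
    case: (j =P i) => [->|/eqP/negbTE ji]; first by have [_ _ HL] := I3; rewrite HL.
    by rewrite inE ji.
  have vB0 : rmem sB 0%N 0%N = (scan x f L i).1 by rewrite -v3.
  have vB1 : rmem sB 0%N 1%N = f (elems x (i :: L)) by [].
  clearbody sB.
  apply: (@wp_seq _ _ _ _ 4 1).
  pose Q s' := inv s' [:: k; t; u; r; i; d1; d2; d3; d4; d5; d6; b; d7;
    (scan x f L i.+1).2] a1 (fun j => j \in L) /\ rmem s' 0%N 0%N = (scan x f L i.+1).1.
  apply: (@wp_weaken _ _ _ 4 _ Q) => // [s4 [I4 v4]|].
    apply: (wp_set_var i.+1 I4) => // [|s5 I5 r5]; first by rd I4; rewrite addn1.
    by split=> //; rewrite r5.
  apply: (@wp_if _ _ _ _ _ 3); rewrite /= vB0 vB1 /Q /= => cmp.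
    rewrite cmp; apply: (@wp_seq _ _ _ _ 1 1); apply: wp_rset => /=.
    apply: (wp_set_var i); [exact: (inv_ext (s := sB) _ _ _ IB) | by [] | | ].
      by rd IB.
    by move=> s5 I5 r5; rewrite r5 /upd.
  rewrite (negbTE cmp); apply: (wp_weaken (N := 1) _ (fun _ => id)) => //.
  exact: wp_skip.
- by split; [rd I3; lia | ].
Qed.

(** At most [2 * t] greedy steps scan at most [t] candidates each, whence the quadratic running
    time. *)
Lemma wp_greedy_loop g4 d1 d2 d3 b g12 g13 w s :
  (0 < b <= t)%N -> (w <= t)%N ->
  inv s [:: k; t; u; r; g4; d1; d2; d3; lo m k u; hi m k t u r; (w + w)%N; b;
            g12; g13] (fun i => (b <= i)%N) pred0 ->
  wp greedy_loop (2 * t * (13 * t + 15) + 3)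
    (fun s' => exists l a2, inv s' [:: k, t, u, r & l]
       (fun i => (b <= i)%N || kept x f m k t u r b (w + w) i) a2) s.
Proof.
move=> /andP[b0 bt] wt I.
apply: (@wp_weaken _ _ _ (1 + ((w + w) * (13 * t + 15)).+1).+1 _ _ _ _ _
  (fun _ => id)); first by nia.
apply: wp_seq; apply: (wp_set_var 0%N I) => // s1 I1 _ /=.
pose J j s' := exists h4 h13, inv s' [:: k; t; u; r; h4; d1; d2; d3; lo m k u;
    hi m k t u r; (w + w)%N; b; j; h13]
  (fun i => (b <= i)%N || kept x f m k t u r b j i)
  (fun i => i \in picks x f b j).
have -> : (13 * t + 15 = (13 * t + 14).+1)%N by lia.
apply: (wp_while (I := J)) => [|j s2 jw [h4 [h13 I2]]|s2 [h4 [h13 I2]]].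
- by exists g4, g13; apply: (inv_ext _ _ _ I1) => // i it; rewrite /kept orbF.
- split; first by rd I2; lia.
  have -> : (13 * t + 14 = (13 * t + 7 + (1 + (2 + 1).+1).+1).+1)%N by lia.
  apply: wp_seq.
  apply: wp_weaken (leqnn _) _ (wp_scan bt _ I2) => [s3 I3|i]; last first.
    exact: picks_lt.
  apply: wp_seq.
  apply: (wp_set_array2 (pick_at x f b j) 1%N
            (fun i => i \in picks x f b j.+1) I3); rd I3.
  move=> s4 I4; apply: wp_seq.
  pose Q s' := inv s' [:: k; t; u; r; b; d1; d2; d3; lo m k u;
      hi m k t u r; (w + w)%N; b; j; pick_at x f b j]
    (fun i => (b <= i)%N || kept x f m k t u r b j.+1 i)
    (fun i => i \in picks x f b j.+1).
  apply: (@wp_weaken _ _ _ 2 _ Q) => // [s5 I5|].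
    apply: (wp_set_var j.+1 I5) => // [|s6 I6 _]; first by rd I5; rewrite addn1.
    by exists b, (pick_at x f b j).
  apply: wp_if => /=; rd I4; rewrite addn1 => jlh.
    apply: (wp_set_array1 (pick_at x f b j) 1%N
      (fun i => (b <= i)%N || kept x f m k t u r b j.+1 i) I4) => //; rd I4.
    by move=> i it; rewrite kept_step jlh; case: eqP => // _; rewrite orbT.
  apply: (wp_weaken (N := 1) _ (fun _ => id)) => //; apply: wp_skip.
  apply: (inv_ext _ _ _ I4) => // i it; rewrite kept_step (negbTE jlh).
  by case: eqP.
- split; first by rd I2; lia.
  by exists [:: h4; d1; d2; d3; lo m k u; hi m k t u r; (w + w)%N; b;
    (w + w)%N; h13], (fun i => i \in picks x f b (w + w)).
Qed.

(** The two seeds are all that the next round relies on; it rebuilds array 1 below its own [t]. *)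
Definition round_post (s : state R) : Prop :=
  [/\ nmem s 0 2 = u, nmem s 0 3 = r &
      forall i, (i < t)%N -> (nmem s 1 i != 0%N) = alg x f m k t u r i].

Lemma age_bound : (k < t)%N -> (age m k t r < t)%N.
Proof.
move=> kt; have := ltn_pmod (t + r * slot m k) epoch_gt0; rewrite -/(age m k t r).
by have := slot_bound; rewrite /epoch; lia.
Qed.

Lemma wp_solution s : nmem s 0 0 = k -> nmem s 0 1 = t -> nmem s 0 2 = u ->
  nmem s 0 3 = r -> (r <= m)%N ->
  wp (If (NLe (var 1) (var 0)) take_all
      (Seq (slot_length m) (Seq (epoch_age m) (Seq (bounds m)
        (Seq clear greedy_loop)))))
    (26 * t * t + 43 * t + 4 * m + 40) round_post s.
Proof.
move=> e0 e1 e2 e3 rm.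
have I : inv s [:: k; t; u; r; nmem s 0 4; nmem s 0 5; nmem s 0 6; nmem s 0 7;
    nmem s 0 8; nmem s 0 9; nmem s 0 10; nmem s 0 11; nmem s 0 12; nmem s 0 13]
    (fun i => nmem s 1 i != 0%N) (fun i => nmem s 2 i != 0%N).
  by split=> //=; rewrite e0 e1 e2 e3.
apply: (@wp_weaken _ _ _ (26 * t * t + 43 * t + 4 * m + 39).+1 _ _ _ _ _
  (fun _ => id)); first by lia.
apply: wp_if => /=; rewrite e0 e1 => tk.
  apply: wp_weaken _ _ (wp_take_all I) => [|s' I']; first by nia.
  split; [by rd I'|by rd I'|].
  by move=> i it; have [_ -> //] := I'; rewrite /alg tk.
rewrite -ltnNge in tk.
pose N5 := (2 * t * (13 * t + 15) + 3)%N.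
pose N4 := ((7 * t + 3) + N5).+1; pose N3 := (10 + N4).+1.
pose N2 := ((4 * m + 4 * t + 9) + N3).+1.
apply: (@wp_weaken _ _ _ (2 * t + 3 + N2).+1 _ _ _ _ _ (fun _ => id)).
  by rewrite /N2 /N3 /N4 /N5; nia.
apply: wp_seq; apply: wp_weaken (leqnn _) _ (wp_slot_length tk I) => s1 I1.
apply: wp_seq; apply: wp_weaken (leqnn _) _ (wp_epoch_age tk rm I1) => s2 I2.
apply: wp_seq; apply: wp_weaken (leqnn _) _ (wp_bounds I2) => s3 I3.
apply: wp_seq; apply: wp_weaken (leqnn _) _ (wp_clear I3) => s4 I4.
have age_t := age_bound tk.
apply: wp_weaken (leqnn _) _ (wp_greedy_loop _ _ I4) => [s5 [l [a2 I5]]||].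
- split; [by rd I5|by rd I5|].
  by move=> i it; have [_ -> //] := I5; rewrite /alg (leqNgt t k) tk.
- by lia.
- by rewrite /wsize; lia.
Qed.

End Verify.

(** The number built by [flips], with [v] as the Horner accumulator. *)
Fixpoint bits_value (c : nat) (w : nat -> bool) (v : nat) : nat :=
  if c is c'.+1 then bits_value c' (fun j => w j.+1) (v + v + w 0%N) else v.

Lemma wp_flips (R : realType) (orc : pred nat -> R) c n s : c != 4 ->
  wp orc (flips c n) (4 * n + 1)
    (fun s' => [/\ nmem s' 0 c = bits_value n (tape s) (nmem s 0 c),
       forall d, d != c -> d != 4 -> nmem s' 0 d = nmem s 0 d &
       tape s' = fun j => tape s (n + j)]) s.
Proof.
move=> c4; elim: n s => [|n IHn] s; first exact: wp_skip.
have -> : (4 * n.+1 + 1 = (1 + (1 + (4 * n + 1)).+1).+1)%N by lia.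
apply: wp_seq; apply: wp_flip; apply: wp_seq; apply: wp_nset => /=.
apply: wp_weaken (leqnn _) _ (IHn _) => s' /= [-> H ->]; split.
- by rewrite /upd /= !eqxx (negbTE c4).
- by move=> d dc d4; rewrite H // /upd /= (negbTE dc) (negbTE d4).
- by [].
Qed.

(** * Expectation over the seeds *)

Section Expect.
Variable R : realType.

Definition scons (b : bool) (w : nat -> bool) (j : nat) : bool :=
  if j is j'.+1 then w j' else b.

Lemma expectS d (F : (nat -> bool) -> R) :
  expect d.+1 F = (expect d (fun w => F (scons false w)) +
                   expect d (fun w => F (scons true w))) / 2.
Proof.
rewrite /expect -mulrDl exprS invfM [2^-1 * _]mulrC mulrA.
congr (_ / _ / _).
pose h (p : bool * d.-tuple bool) : d.+1.-tuple bool := [tuple of p.1 :: p.2].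
have hK : {on predT, bijective h}.
  exists (fun v : d.+1.-tuple bool => (thead v, behead_tuple v)).
    by case=> b w _; congr (_, _); apply: val_inj.
  by move=> v _; rewrite [RHS]tuple_eta; apply: val_inj.
rewrite (reindex _ hK) /=.
rewrite -(pair_big xpredT xpredT (fun b w => F (nth false (h (b, w))))) /=.
rewrite big_bool /= addrC; congr (_ + _); apply: eq_bigr => w _; congr F;
  by apply/funext => -[].
Qed.

Lemma expect_cst d (a : R) : expect d (fun => a) = a.
Proof.
rewrite /expect sumr_const card_tuple card_bool -[a *+ _]mulr_natr natrX mulfK //.
by rewrite expf_neq0 // pnatr_eq0.
Qed.

(** The first [c] bits form a uniform integer independent of the other [d]. A general [v] serves the
    induction, in which each bit doubles the accumulator. *)
Lemma expect_bits c d v (Psi : nat -> (nat -> bool) -> R) :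
  expect (c + d) (fun w => Psi (bits_value c w v) (fun j => w (c + j)%N)) =
  (\sum_(0 <= i < 2 ^ c) expect d (Psi (v * 2 ^ c + i)%N)) / 2 ^+ c.
Proof.
elim: c v Psi => [|c IHc] v Psi.
  by rewrite expn0 big_nat1 muln1 addn0 divr1.
rewrite addSn expectS.
have step b : expect (c + d) (fun w => Psi (bits_value c.+1 (scons b w) v)
      (fun j => scons b w (c.+1 + j)%N)) =
    (\sum_(0 <= i < 2 ^ c) expect d (Psi (v * 2 ^ c.+1 + (b * 2 ^ c + i))%N)) / 2 ^+ c.
  rewrite -[LHS]/(expect (c + d) (fun w => Psi (bits_value c w (v + v + b))
    (fun j => w (c + j)%N))) IHc; congr (_ / _).
  by apply: eq_bigr => i _; congr (expect d (Psi _)); rewrite expnS; nia.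
rewrite !step -mulrDl exprS invfM [2^-1 * _]mulrC mulrA.
congr (_ / _ / _); apply/esym.
have -> : (2 ^ c.+1 = 2 ^ c + 2 ^ c)%N by rewrite expnS; lia.
rewrite (@big_cat_nat _ _ _ (2 ^ c)%N) ?leq_addr //=; congr (_ + _).
rewrite -{1}[(2 ^ c)%N]add0n big_addn addnK; apply: eq_bigr => i _.
by rewrite mul1n [(i + _)%N]addnC.
Qed.

End Expect.

Lemma bits_value_lt c w v : (bits_value c w v < v.+1 * 2 ^ c)%N.
Proof.
elim: c w v => [|c IHc] w v /=; first by rewrite expn0 muln1.
apply: leq_trans (IHc _ _) _; rewrite expnS.
by case: (w 0%N) => /=; move: (2 ^ c)%N => p; nia.
Qed.

(** * The solution maintained for fixed seeds *)

Section Solution.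
Variables (R : realType) (n : nat) (X : finType) (x : 'I_n -> X).
Variable f : {set X} -> R.

Lemma elems_card l : (#|elems x l| <= size l)%N.
Proof.
apply: leq_trans (leq_imset_card _ _) _; rewrite cardE -(size_map val).
apply: uniq_leq_size; first by rewrite map_inj_uniq ?enum_uniq //; exact: val_inj.
by move=> _ /mapP[i + ->]; rewrite mem_enum inE.
Qed.

Lemma mem_elems (i : 'I_n) l : (i : nat) \in l -> x i \in elems x l.
Proof. by move=> il; apply/imsetP; exists i; rewrite ?inE. Qed.

Lemma mem_select t (p : pred nat) (i : 'I_n) : (i < t)%N -> p i -> x i \in select x t p.
Proof. by move=> it pi; apply/imsetP; exists i; rewrite ?inE ?it. Qed.

Lemma elems_cons (i : 'I_n) l : elems x ((i : nat) :: l) = x i |: elems x l.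
Proof.
apply/setP => y; apply/imsetP/setU1P => [[j]|].
  rewrite !inE => /orP[/eqP/val_inj->|jl] ->; first by left.
  by right; exact: mem_elems.
case=> [->|/imsetP[j]]; first by exists i; rewrite ?inE ?eqxx.
by rewrite inE => jl ->; exists j; rewrite ?inE ?jl ?orbT.
Qed.

Lemma elems_sub (l l' : seq nat) : {subset l <= l'} -> elems x l \subset elems x l'.
Proof.
move=> ll'; apply/subsetP => _ /imsetP[i + ->]; rewrite inE => /ll'.
exact: mem_elems.
Qed.

Lemma mem_picks b j i :
  (i \in picks x f b j) = (i \in [seq pick_at x f b l | l <- iota 0 j]).
Proof.
elim: j => // j IHj; rewrite -[in iota 0 j.+1]addn1 iotaD map_cat mem_cat /=.
by rewrite !inE IHj orbC.
Qed.

Lemma scan_max l b i : (i < b)%N -> f (elems x (i :: l)) <= (scan x f l b).1.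
Proof.
elim: b => // b IHb; rewrite ltnS leq_eqVlt => /orP[/eqP->|/IHb le_b] /=.
  by case: ifPn => //=; rewrite -ltNge => /ltW.
by case: ifP => //= /(le_trans le_b).
Qed.

(** Non-negativity lets the first candidate replace the initial value 0, so the recorded value is
    attained. *)
Lemma scan_value l b : nonneg_fun f -> (0 < b)%N ->
  (scan x f l b).1 = f (elems x ((scan x f l b).2 :: l)).
Proof.
move=> fpos; case: b => // b _; elim: b => [|b IHb].
  by rewrite /= fpos.
by rewrite [scan _ _ _ _.+1]/= -/(scan x f l b.+1); case: ifP.
Qed.

(** Provides the hypothesis [best_step] of the abstract greedy sequence. *)
Lemma picks_best b j y : nonneg_fun f -> y \in arrived x b ->
  f (y |: elems x (picks x f b j)) <= f (elems x (picks x f b j.+1)).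
Proof.
move=> fpos /imsetP[i]; rewrite inE andbT => ib ->; rewrite -elems_cons.
apply: le_trans (scan_max _ ib) _; rewrite scan_value //.
exact: leq_ltn_trans ib.
Qed.

Variables (m k : nat).
Hypothesis m0 : (0 < m)%N.
Notation sol := (fun t u r => select x t (alg x f m k t u r)).

Definition pick_range b i c := [seq pick_at x f b l | l <- iota i c].

Lemma kept_mem t u r b j i : kept x f m k t u r b j i ->
  i \in pick_range b (lo m k u) (hi m k t u r - lo m k u).
Proof.
case/hasP => l _ /andP[lh /eqP <-]; apply: map_f; rewrite mem_iota; lia.
Qed.

Lemma window_le t u r : (hi m k t u r - lo m k u <= wsize m k)%N.
Proof. by rewrite /hi; lia. Qed.

(** After round [k], the window holds at most [k - m * slot] picks, and the age, which counts the
    newer elements, is at most [m * slot], also when [slot] is 0. *)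
Lemma sol_card t u r : (#|sol t u r| <= k)%N.
Proof.
have [tk|kt] := leqP t k.
  apply: leq_trans tk; rewrite -[X in (_ <= X)%N](size_iota 0 t).
  apply: leq_trans (elems_card _); apply/subset_leq_card/subsetP => y.
  case/imsetP => i; rewrite inE => /andP[it _] ->; apply: mem_elems.
  by rewrite mem_iota.
set b := (t - age m k t r)%N.
pose l := iota b (t - b) ++ pick_range b (lo m k u) (hi m k t u r - lo m k u).
apply: (@leq_trans (size l)); last first.
  rewrite size_cat size_map !size_iota; have := window_le t u r.
  have := age_bound r m0 kt.
  have := ltn_pmod (t + r * slot m k) (epoch_gt0 k m0).
  have := slot_bound k m0; rewrite -/(age m k t r) /b /epoch /wsize.
  by lia.
apply: leq_trans (elems_card _); apply/subset_leq_card/subsetP => y.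
case/imsetP => i; rewrite inE => /andP[it ai] ->; apply: mem_elems.
rewrite mem_cat mem_iota; apply/orP.
move: ai; rewrite /alg leqNgt kt /= => /orP[bi|/kept_mem]; last by right.
by left; rewrite /b in bi *; lia.
Qed.

Lemma age_next t r :
  age m k t.+1 r = (age m k t r).+1 \/ age m k t.+1 r = 0%N.
Proof.
rewrite /age addSn; set a := (t + _)%N; set e := epoch m k.
have e0 : (0 < e)%N by exact: epoch_gt0.
have := ltn_pmod a e0; rewrite leq_eqVlt => /orP[/eqP ae|ae].
  by right; rewrite -addn1 -modnDml addn1 ae modnn.
by left; rewrite -addn1 -modnDml addn1 modn_small.
Qed.

(** Inside an epoch only the arriving element and the next [m * m] picks can enter. At age 0 only
    the first [m * m] picks of the new window can. *)
Lemma sol_consistent t u r : (#|sol t.+1 u r :\: sol t u r| <= m * m + 1)%N.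
Proof.
suff [l sl Hl] : exists2 l, (size l <= m * m + 1)%N &
    forall i, (i < t.+1)%N -> alg x f m k t.+1 u r i ->
      ((i < t)%N -> ~~ alg x f m k t u r i) -> i \in l.
  apply: leq_trans (leq_trans (elems_card l) sl).
  apply/subset_leq_card/subsetP => y /setDP[/imsetP[i + ->]].
  rewrite inE => /andP[it ai] ns; apply/mem_elems/Hl => // i_t.
  by apply: contra ns => ai'; exact: mem_select.
have [tk|kt] := leqP t k.
  exists [:: t] => [|i it _ H]; first by rewrite addn1.
  rewrite inE; have [i_t|] := ltnP i t; last by lia.
  by have := H i_t; rewrite /alg tk.
rewrite /alg ltnNge (ltnW kt) leqNgt kt /=.
set b := (t - age m k t r)%N.
have [an|an] := age_next t r; last first.
  exists (pick_range t.+1 (lo m k u) (hi m k t.+1 u r - lo m k u)).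
    by rewrite size_map size_iota /hi an; lia.
  move=> i it; rewrite an subn0 leqNgt it /=; move/kept_mem => //.
have -> : (t.+1 - age m k t.+1 r = b)%N by rewrite an subSS.
exists (t :: pick_range b (hi m k t u r) (hi m k t.+1 u r - hi m k t u r)).
  rewrite /= size_map size_iota /hi an.
  by move: (m * m)%N (age m k t r) (wsize m k) (lo m k u) => p q s v; nia.
move=> i it /orP[bi H|/hasP[l li /andP[lh /eqP pl]] H].
  have [i_t|] := ltnP i t; last by rewrite inE; lia.
  by have := H i_t; rewrite bi.
have [i_t|] := ltnP i t; last by rewrite inE; lia.
rewrite inE -pl map_f ?orbT // mem_iota.
have [lh'|] := ltnP l (hi m k t u r); last by lia.
have /negP[] := H i_t; rewrite orbC; apply/orP; left.
by apply/hasP; exists l => //; rewrite pl eqxx andbT; lia.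
Qed.

(** An epoch consists of [m] slots, and a small age puts [t + r * slot] into the first of them. *)
Lemma bad_shift t r : (age m k t r < slot m k)%N -> (m %| t %/ slot m k + r)%N.
Proof.
move=> bad; have d0 : (0 < slot m k)%N by lia.
have ee : epoch m k = (m * slot m k)%N by rewrite /epoch; nia.
have := divn_eq (t + r * slot m k) (epoch m k); rewrite -/(age m k t r) ee.
set q := (_ %/ _)%N => eq_t.
have : ((t + r * slot m k) %/ slot m k = q * m)%N.
  by rewrite eq_t mulnA divnMDl // divn_small // addn0.
by rewrite addnC divnMDl // addnC => ->; rewrite dvdn_mull.
Qed.

(** Two bad shifts are congruent modulo [m]. *)
Lemma bad_shift_uniq t r1 r2 : (r1 < m)%N -> (r2 < m)%N ->
  (age m k t r1 < slot m k)%N -> (age m k t r2 < slot m k)%N -> r1 = r2.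
Proof.
wlog le12 : r1 r2 / (r1 <= r2)%N.
  by move=> H r1m r2m b1 b2; case/orP: (leq_total r1 r2) => le;
     [|apply/esym]; apply: H.
move=> _ r2m /bad_shift d1 /bad_shift d2.
have := dvdn_sub d2 d1; rewrite subnDl => /dvdnP[[|c]]; first by lia.
by rewrite mulSn; lia.
Qed.

End Solution.

Lemma sumr_const_nat2 (R : pzRingType) (a : R) p q :
  \sum_(0 <= r < p) \sum_(0 <= u < q) a = a * q%:R * p%:R.
Proof.
rewrite (eq_bigr (fun=> a *+ q)) => [|r _]; last by rewrite sumr_const_nat subn0.
by rewrite sumr_const_nat subn0 !mulr_natr.
Qed.

(** * Mean value of the solution over both seeds *)

Section Approximation.
Variables (R : realType) (n : nat) (X : finType) (x : 'I_n -> X).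
Variable f : {set X} -> R.
Hypotheses (fpos : nonneg_fun f) (fmono : monotone_fun f) (fsub : submodular f).
Variables (m k : nat).
Hypothesis m1 : (1 < m)%N.
Notation sol := (fun t u r => select x t (alg x f m k t u r)).

Lemma OPT_feasible t :
  (OPT x f k t \subset arrived x t) && (#|OPT x f k t| <= k)%N.
Proof.
rewrite /OPT; case: arg_maxP => [|S //]; by rewrite sub0set cards0.
Qed.

(** Since [m * m * (slot + 1)] exceeds [k], the whole window is in place once the age reaches
    [slot]. *)
Lemma sol_full_window t u r l : (k < t)%N -> (slot m k <= age m k t r)%N ->
  (lo m k u <= l < lo m k u + wsize m k)%N ->
  alg x f m k t u r (pick_at x f (t - age m k t r) l).
Proof.
move=> kt ga ll.
have mm0 : (0 < m * m)%N by rewrite muln_gt0; lia.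
have hiE : hi m k t u r = (lo m k u + wsize m k)%N.
  have := ltn_ceil k mm0; rewrite -/(slot m k) /hi /wsize.
  by move: (m * m)%N ga => p ga; nia.
rewrite /alg; apply/orP; right; apply/orP; right.
apply/hasP; exists l; last by rewrite hiE ll eqxx.
by rewrite mem_iota; move: ll; rewrite /lo; case: ifP => _; lia.
Qed.

(** With a complete window, 29 seeds give a superset of [A w :|: N] and 3 a superset of [G :|: N].
    Then [two_windows] applies to the part of the optimum that arrived before the epoch. *)
Lemma sol_good t r : (0 < k < t)%N -> (slot m k <= age m k t r)%N ->
  32 * ((51 / 100 - 1 / m%:R) * f (OPT x f k t)) <=
  \sum_(0 <= u < 32) f (sol t u r).
Proof.
move=> /andP[k0 kt] ga; have m0 : (0 < m)%N by exact: ltnW.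
set b := (t - age m k t r)%N; set w := wsize m k.
have age_t := age_bound r m0 kt.
have b0 : (0 < b)%N by rewrite subn_gt0.
have bt : (b <= t)%N by exact: leq_subr.
pose A j := elems x (picks x f b j).
pose G := elems x (pick_range x f b w w).
pose N := select x t (fun i => (b <= i)%N).
pose O := OPT x f k t :&: arrived x b.
have /andP[Osub Ok] := OPT_feasible t.
have AG : A w :|: G = A (w + w)%N.
  apply/setP => y; rewrite inE; apply/orP/imsetP.
    case=> /imsetP[i]; rewrite inE => il ->; exists i => //; rewrite inE.
      by move: il; rewrite !mem_picks iotaD map_cat mem_cat => ->.
    by move: il; rewrite mem_picks iotaD map_cat mem_cat add0n => ->; rewrite orbT.
  case=> i; rewrite inE mem_picks iotaD map_cat mem_cat => /orP[] il ->.
    by left; apply: mem_elems; rewrite mem_picks.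
  by right; apply: mem_elems.
have two : (51 / 100 - 1 / m%:R) * f (O :|: N) <=
    (29 * f (A w :|: N) + 3 * f (G :|: N)) / 32.
  apply: (@two_windows _ _ f fmono fsub (arrived x b) A _ _ O k) => //.
  - by move=> j; apply: elems_sub => i il; rewrite inE il orbT.
  - by move=> j y; exact: picks_best.
  - exact: subsetIr.
  - by apply: leq_trans Ok; apply/subset_leq_card/subsetIl.
  - by rewrite /w /wsize leq_subr.
  - rewrite /w /wsize subKn; last exact: slot_bound.
    by rewrite mulnA mulnC leq_trunc_div.
have OPTle : f (OPT x f k t) <= f (O :|: N).
  apply: fmono; apply/subsetP => y yO; have := subsetP Osub _ yO.
  case/imsetP => i; rewrite inE andbT => it yi; rewrite inE.
  have [bi|ib] := leqP b i; apply/orP; [right|left].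
    by rewrite yi; exact: mem_select.
  by rewrite inE yO yi; exact: mem_select.
have Nsub u : N \subset sol t u r.
  apply/subsetP => _ /imsetP[i + ->]; rewrite inE => /andP[it bi].
  by apply: mem_select => //; rewrite /alg bi orbT.
have Gsub u : (u <= 2)%N -> G :|: N \subset sol t u r.
  move=> u2; rewrite subUset Nsub andbT; apply/subsetP => _ /imsetP[i + ->].
  rewrite inE => /mapP[l]; rewrite mem_iota => lw il.
  apply: mem_select; rewrite il; last by apply: sol_full_window; rewrite ?/lo ?u2.
  exact: leq_trans (pick_lt _ _ _ b0) bt.
have Hsub u : (2 < u)%N -> A w :|: N \subset sol t u r.
  move=> u2; rewrite subUset Nsub andbT; apply/subsetP => _ /imsetP[i + ->].
  rewrite inE mem_picks => /mapP[l]; rewrite mem_iota => lw il.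
  apply: mem_select; rewrite il.
    exact: leq_trans (pick_lt _ _ _ b0) bt.
  by apply: sol_full_window; rewrite // /lo (leqNgt u 2) u2.
rewrite (@big_cat_nat _ _ _ 3) //=.
have G3 : 3 * f (G :|: N) <= \sum_(0 <= u < 3) f (sol t u r).
  apply: (@le_trans _ _ (\sum_(0 <= u < 3) f (G :|: N))).
    by rewrite sumr_const_nat subn0 mulr_natl.
  by apply: ler_sum_nat => u /andP[_ u3]; apply/fmono/Gsub.
have H29 : 29 * f (A w :|: N) <= \sum_(3 <= u < 32) f (sol t u r).
  apply: (@le_trans _ _ (\sum_(3 <= u < 32) f (A w :|: N))).
    by rewrite sumr_const_nat mulr_natl.
  by apply: ler_sum_nat => u /andP[u3 _]; apply/fmono/Hsub.
(* A non-negative coefficient allows [f (O :|: N)] to be lowered to the optimum; this is where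
   [1 < m] enters. *)
have c0 : 0 <= 51 / 100 - 1 / m%:R :> R.
  rewrite subr_ge0 ler_pdivrMr ?ltr0n //.
  by have : 2 <= m%:R :> R by [rewrite ler_nat]; lra.
have {OPTle} := ler_wpM2l c0 OPTle; set a1 := _ * f (OPT _ _ _ _).
move: two G3 H29; set a2 := _ * f (O :|: N).
move: (f (A w :|: N)) (f (G :|: N)) (\sum_(0 <= u < 3) _) (\sum_(3 <= u < 32) _).
clearbody a1 a2 => y z s1 s2; lra.
Qed.

(** At most one of the [m] shifts is bad, and it contributes at least 0. With [e = 1 / m],
    [(1 - e) * (51 / 100 - e)] is at least [51 / 100 - 2 * e]. *)
Lemma sol_mean t :
  (51 / 100 - 2 / m%:R) * f (OPT x f k t) <=
  (\sum_(0 <= u < 32) (\sum_(0 <= r < m) f (sol t u r)) / m%:R) / 32.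
Proof.
have /andP[Osub Ok] := OPT_feasible t.
have mR : 2 <= m%:R :> R by rewrite ler_nat.
have mR0 : 0 < m%:R :> R by lra.
have F0 := fpos (OPT x f k t).
have im : 0 < 1 / m%:R :> R by rewrite divr_gt0.
have im2 : 1 / m%:R <= 1 / 2 :> R by rewrite ler_pdivrMr //; lra.
have e2 : 2 / m%:R = 2 * (1 / m%:R) :> R by rewrite mul1r.
rewrite e2 -mulr_suml exchange_big /= ler_pdivlMr // ler_pdivlMr //.
(* In these cases every solution contains the optimum. *)
have [easy|] := boolP ((t <= k)%N || (k == 0)%N).
  apply: (@le_trans _ _ (\sum_(0 <= r < m) \sum_(0 <= u < 32) f (OPT x f k t))).
    rewrite sumr_const_nat2.
    rewrite ler_pM2r // ler_pM2r // ler_piMl //; lra.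
  apply: ler_sum => r _; apply: ler_sum => u _; apply: fmono.
  case/orP: easy => [tk|/eqP kE]; last first.
    by move: Ok; rewrite kE leqn0 cards_eq0 => /eqP->; exact: sub0set.
  apply: subset_trans Osub _; apply/subsetP => _ /imsetP[i + ->].
  rewrite inE andbT => it; apply: mem_select => //.
  by rewrite /alg tk.
rewrite negb_or -ltnNge -lt0n andbC => kt.
set c := 32 * ((51 / 100 - 1 / m%:R) * f (OPT x f k t)).
have c0 : 0 <= c by apply: mulr_ge0 => //; apply: mulr_ge0 => //; lra.
suff H : m.-1%:R * c <= \sum_(0 <= r < m) \sum_(0 <= u < 32) f (sol t u r).
  apply: le_trans H.
  have -> : m.-1%:R = (1 - 1 / m%:R) * m%:R :> R.
    by rewrite mulrBl !mul1r mulVf ?gt_eqF // -subn1 natrB // ltnW.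
  have eF : 0 <= (1 / m%:R) * (1 / m%:R) * f (OPT x f k t) * m%:R.
    by do ?[apply: mulr_ge0]; rewrite ?invr_ge0 // ltW.
  have eG : 0 <= (1 / m%:R) * f (OPT x f k t) * m%:R.
    by do ?[apply: mulr_ge0]; rewrite ?invr_ge0 // ltW.
  rewrite /c; move: (1 / m%:R : R) (m%:R : R) (f _) eF eG => e p F.
  by lra.
rewrite big_mkord.
have pos (r : 'I_m) : 0 <= \sum_(0 <= u < 32) f (sol t u r).
  by apply: sumr_ge0 => u _; exact: fpos.
have [/existsP[r0 bad]|/existsPn good] :=
    boolP [exists r : 'I_m, age m k t r < slot m k]%N.
  rewrite (bigD1 r0) //= -[leLHS]add0r; apply: lerD => //.
  have -> : m.-1%:R * c = \sum_(r < m | r != r0) c.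
    by rewrite sumr_const cardC1 card_ord mulr_natl.
  apply: ler_sum => r rr0; apply: sol_good => //; rewrite leqNgt.
  apply: contra rr0 => bad'; apply/eqP/val_inj.
  by apply: bad_shift_uniq bad' bad => //; exact: ltnW.
apply: (@le_trans _ _ (\sum_(r < m) c)).
  by rewrite sumr_const card_ord -[leRHS]mulr_natl ler_wpM2r // ler_nat leq_pred.
by apply: ler_sum => r _; apply: sol_good => //; rewrite leqNgt.
Qed.

End Approximation.

(** * The runs of the program *)

Section Runs.
Variables (R : realType) (n : nat) (X : finType) (x : 'I_n -> X).
Variable f : {set X} -> R.
Variables (M k T : nat).
Let m := (2 ^ M)%N.
Hypothesis T_large :
  forall t, (t <= n)%N -> (26 * t * t + 43 * t + 4 * m + 4 * M + 70 <= T)%N.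

Definition window_seed (w : nat -> bool) : nat := bits_value 5 w 0.
Definition shift_seed (w : nat -> bool) : nat :=
  bits_value M (fun j => w (5 + j)%N) 0.

Lemma shift_seed_lt w : (shift_seed w < m)%N.
Proof. by have := bits_value_lt M (fun j => w (5 + j)%N) 0; rewrite mul1n. Qed.

Let post w t := round_post x f m k t (window_seed w) (shift_seed w).

(** The first round starts from zero memory and an unread tape, so the seeds are the first [5 + M]
    bits; later rounds inherit them through [post]. *)
Lemma wp_main w t s :
  (t = 0%N -> s = start R w) -> ((0 < t)%N -> post w t s) -> (t < n)%N ->
  wp (fun p => f (select x t.+1 p)) (main M m) T (post w t.+1)
    (arrive k t.+1 s).
Proof.
move=> s0 st tn; have m0 : (0 < m)%N by rewrite expn_gt0.
pose N1 := (4 * 5 + 1 + (4 * M + 1)).+2.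
pose N2 := (26 * t.+1 * t.+1 + 43 * t.+1 + 4 * m + 40)%N.
apply: (@wp_weaken _ _ _ (N1 + N2).+1 _ _ _ _ _ (fun _ => id)).
  by apply: leq_trans (T_large tn); rewrite /N1 /N2; lia.
apply: wp_seq.
pose Q (s' : state R) := [/\ nmem s' 0 0 = k, nmem s' 0 1 = t.+1,
  nmem s' 0 2 = window_seed w & nmem s' 0 3 = shift_seed w].
apply: (@wp_weaken _ _ _ N1 _ Q) => // [s' [e0 e1 e2 e3]|].
  by apply: wp_solution => //; exact: ltnW (shift_seed_lt w).
apply: wp_if => /=; rewrite /upd /= => t1.
  have t0 : t = 0%N by lia.
  rewrite (s0 t0) t0; apply: wp_seq.
  apply: wp_weaken (leqnn _) _ (wp_flips _ _ _ _) => // s1 [e2 H1 tp].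
  apply: wp_weaken (leqnn _) _ (wp_flips _ _ _ _) => // s2 [e3 H2 _].
  split; [by rewrite H2 ?H1|by rewrite H2 ?H1 // t0| |by rewrite e3 tp H1].
  by rewrite H2 ?e2.
have t0 : (0 < t)%N by lia.
have [e2 e3 _] := st t0.
by apply: (wp_weaken (N := 1) _ (fun _ => id)) => //; apply: wp_skip; split.
Qed.

Lemma run_round w t : (t < n)%N ->
  (round x f (main M m) k T t.+1 (state_after x f (main M m) k T w t)).1 = [::] /\
  post w t.+1 (state_after x f (main M m) k T w t.+1).
Proof.
elim: t => [|t IHt] tn.
  have W := @wp_main w 0 (start R w) (fun _ => erefl) ltac:(by []) tn.
  by have [s' E P] := wp_halts W (leqnn _); rewrite /= /round E.
have [_ P0] := IHt (ltnW tn).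
have W := @wp_main w t.+1 (state_after x f (main M m) k T w t.+1)
  ltac:(by []) (fun _ => P0) tn.
by have [s' E P] := wp_halts W (leqnn _); rewrite [state_after _ _ _ _ _ _ t.+2]/= /round E.
Qed.

Lemma ALG_sol w t : (t <= n)%N -> ALG x f (main M m) k T w t =
  select x t (alg x f m k t (window_seed w) (shift_seed w)).
Proof.
case: t => [|t] tn.
  by apply/setP => y; apply/imsetP/imsetP => -[i]; rewrite inE.
have [_ [_ _ H]] := run_round w tn.
apply/setP => y; apply/imsetP/imsetP => -[i]; rewrite inE => /andP[it ai] ->;
  exists i => //; rewrite inE it /=; last by rewrite H.
by rewrite -H.
Qed.

Lemma expect_ALG t : (0 < t <= n)%N ->
  expect (n * T) (fun w => f (ALG x f (main M m) k T w t)) =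
  (\sum_(0 <= u < 32)
    (\sum_(0 <= r < m) f (select x t (alg x f m k t u r))) / m%:R) / 32.
Proof.
move=> /andP[t0 tn]; have n0 : (0 < n)%N by lia.
(* The remaining [d] bits do not influence the seeds and average out. *)
have [d ->] : exists d, (n * T = 5 + (M + d))%N.
  exists (n * T - (5 + M))%N; rewrite addnA subnKC //.
  by apply: (@leq_trans T); [have := T_large tn; lia | exact: leq_pmull].
pose Phi u r := f (select x t (alg x f m k t u r)).
pose Psi u (w : nat -> bool) := Phi u (bits_value M w 0).
have -> : (fun w => f (ALG x f (main M m) k T w t)) =
    (fun w => Psi (bits_value 5 w 0) (fun j => w (5 + j)%N)).
  by apply/funext => w; rewrite ALG_sol.
rewrite expect_bits; congr (_ / _); last by rewrite -natrX.
apply: eq_bigr => u _; rewrite mul0n add0n.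
rewrite (expect_bits M d 0 (fun r _ => Phi u r)) natrX; congr (_ / _).
by apply: eq_bigr => r _; rewrite expect_cst mul0n add0n.
Qed.

End Runs.

(** A power of two makes [M] fair bits a uniform shift; the least exponent keeps it within a factor
    2 of [1 / eps]. *)
Lemma power_of_two_near (R : realType) (eps : R) : 0 < eps < 1 ->
  exists M, (0 < M)%N /\ 1 / eps <= (2 ^ M)%:R <= 2 / eps.
Proof.
move=> /andP[e0 e1].
have i0 : 1 < 1 / eps by rewrite ltr_pdivlMr // mul1r.
have ex : exists M, 1 / eps <= (2 ^ M)%:R.
  exists (Num.bound (1 / eps)).
  have := archi_boundP (ltW (lt_trans ltr01 i0)) => /ltW/le_trans; apply.
  by rewrite ler_nat ltnW // ltn_expl.
case: (ex_minnP ex) => M le_M min_M; exists M.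
have M0 : (0 < M)%N.
  by case: M le_M {min_M} => //; rewrite expn0 leNgt i0.
split=> //; rewrite le_M /=.
have [|lt] := leP (1 / eps) (2 ^ M.-1)%:R; first by move/min_M; lia.
have -> : (2 ^ M = 2 * 2 ^ M.-1)%N by rewrite -expnS prednK.
by rewrite natrM -[eps^-1]mul1r ler_pM2l // ltW.
Qed.

Theorem theorem7 (R : realType) :
  exists C1 C2 : R, [/\ 0 < C1, 0 < C2 &
    forall eps : R, 0 < eps < 1 ->
    exists (A : cmd) (P : {poly nat}),
    forall (n k : nat) (X : finType) (x : 'I_n -> X) (f : {set X} -> R),
      bijective x -> nonneg_fun f -> monotone_fun f -> submodular f ->
      let T := P.[n] in
      [/\ halts_in_time x f A k T,
          feasible x f A k T,
          consistent x f A k T (C1 / eps ^+ 2) &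
          approximates x f A k T (51 / 100 - C2 * eps)]].
Proof.
(* From [m <= 2 / eps] follows [m * m + 1 <= 5 / eps ^+ 2], and from [1 / eps <= m] follows
   [2 / m <= 2 * eps]. *)
exists 5, 2; split=> // eps eps01.
have [M [M0 /andP[m_ge m_le]]] := power_of_two_near eps01.
have /andP[e0 e1] := eps01.
set m := (2 ^ M)%N in m_ge m_le.
(* The step bound of [T_large] at [t = n], constant coefficient first. *)
exists (main M m), (Poly [:: (4 * m + 4 * M + 70)%N; 43%N; 26%N]).
move=> n k X x f _ fpos fmono fsub T.
have T_large t : (t <= n)%N ->
    (26 * t * t + 43 * t + 4 * m + 4 * M + 70 <= T)%N.
  rewrite /T horner_Poly /=.
  change (t <= n -> 26 * t * t + 43 * t + 4 * m + 4 * M + 70 <=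
    ((0 * n + 26) * n + 43) * n + (4 * m + 4 * M + 70))%N.
  by nia.
have m1 : (1 < m)%N by rewrite -[1%N](expn0 2) ltn_exp2l.
have mR : 0 < m%:R :> R by rewrite ltr0n ltnW.
split.
- by move=> w t tn; have [] := run_round x f k T_large w tn.
- by move=> w t tn; rewrite (ALG_sol x f k T_large w tn) sol_card // ltnW.
- move=> w t tn; rewrite (ALG_sol x f k T_large w tn) (ALG_sol x f k T_large w (ltnW tn)).
  apply: (@le_trans _ _ (m * m + 1)%:R).
    by rewrite ler_nat sol_consistent // ltnW.
  rewrite natrD natrM ler_pdivlMr ?exprn_gt0 //.
  rewrite ler_pdivlMr // in m_le.
  have := ler_pM _ _ m_le m_le; nra.
- move=> t t0n; rewrite (expect_ALG x f k T_large t0n).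
  apply: le_trans (sol_mean _ fpos fmono fsub _ m1 _).
  apply: ler_wpM2r => //; rewrite lerD2l lerN2.
  rewrite ler_pdivrMr // -mulrA ler_peMr //.
  by rewrite mulrC -ler_pdivrMr.
Qed.
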